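(* Let $(X,d)$ be a uniformly perfect metric space and let $(B_i)_{i=1}^\infty$ be a sequence of closed balls in $X$ such that $(\operatorname{diam}(B_i))_{i=1}^\infty \in \ell^0$. Then the set $$E := X \setminus \bigcup_{i=1}^\infty B_i$$ is fat or thin.
   Context: $B(x,r)=\{y\in X: d(x,y)\le r\}$, $r>0$, denotes the closed ball. A metric space $X$ is uniformly perfect (with constant $D$) if it is not a singleton and there is a constant $D\ge 1$ such that for all $x\in X$ and $r>0$: $X\setminus B(x,r)\ne\emptyset$ implies $B(x,r)\setminus B(x,r/D)\neq\emptyset$. A Borel regular outer measure $\mu$ on a metric space $(X,d)$ is doubling if there is a constant $C\ge 1$ (depending only on $\mu$) such that $0<\mu(B(x,2r))\le C\mu(B(x,r))<\infty$ for all $x\in X$ and $r>0$. $\mathcal{D}(X)$ denotes the collection of all doubling measures on $X$. A set $A\subset X$ is fat if $\mu(A)>0$ for every $\mu\in\mathcal{D}(X)$, and thin if $\mu(A)=0$ for every $\mu\in\mathcal{D}(X)$. (If $\mathcal{D}(X)=\emptyset$, every set is both fat and thin.) For $p>0$, $\ell^p:=\{(\alpha_n)_{n=1}^\infty : 0<\alpha_n<1 \text{ for all } n \text{ and } \sum_{n=1}^\infty \alpha_n^p<\infty\}$, and $\ell^0:=\bigcap_{p>0}\ell^p$. *)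

(* Defs.v *)
From mathcomp Require Import all_boot all_order all_algebra.
From mathcomp Require Import all_classical all_reals all_analysis.

Set Implicit Arguments.
Unset Strict Implicit.
Unset Printing Implicit Defensive.

Import Order.TTheory GRing.Theory Num.Theory.
Import numFieldNormedType.Exports.

Local Open Scope classical_set_scope.
Local Open Scope ring_scope.

(* This is not the library's [closed_ball], which is the closure of the open
   ball and may be strictly smaller in a general metric space. *)
Definition cball (R : realType) (X : metricType R) (x : X) (r : R) : set X :=
  [set y | mdist x y <= r].

Definition diam (R : realType) (X : metricType R) (A : set X) : \bar R :=
  ereal_sup [set (mdist z.1 z.2)%:E | z in A `*` A].

Definition uniformly_perfect (R : realType) (X : metricType R) : Prop :=
  ~ (exists x : X, [set: X] = [set x]) /\
  exists2 D : R, 1 <= D &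
    forall (x : X) (r : R), 0 < r ->
      ([set: X] `\` cball x r) !=set0 ->
      (cball x r `\` cball x (r / D)) !=set0.

Definition borel_set (T : topologicalType) : set (set T) := <<s @open T >>.

Definition borel_regular (R : realType) (T : topologicalType)
    (mu : {outer_measure set T -> \bar R}) : Prop :=
  (forall A : set T, borel_set A -> mu.-caratheodory A) /\
  (forall A : set T, exists B : set T,
     [/\ borel_set B, A `<=` B & mu B = mu A]).

Definition doubling_measures (R : realType) (X : metricType R) :
    set {outer_measure set X -> \bar R} :=
  [set mu | borel_regular mu /\
    exists2 C : R, 1 <= C &
      forall (x : X) (r : R), 0 < r ->
        [/\ (0 < mu (cball x (2 * r)))%E,
            (mu (cball x (2 * r)) <= C%:E * mu (cball x r))%E &
            (C%:E * mu (cball x r) < +oo)%E]].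

Arguments doubling_measures {R} X.

Definition fat (R : realType) (X : metricType R) (A : set X) : Prop :=
  forall mu, doubling_measures X mu -> (0 < mu A)%E.

Definition thin (R : realType) (X : metricType R) (A : set X) : Prop :=
  forall mu, doubling_measures X mu -> mu A = 0%E.

Definition ellp (R : realType) (p : R) : set (nat -> R) :=
  [set a | (forall n, 0 < a n < 1) /\
           (\sum_(0 <= n <oo) (a n `^ p)%:E < +oo)%E].

Definition ell0 (R : realType) : set (nat -> R) :=
  \bigcap_(p in [set p : R | 0 < p]) ellp p.

Arguments ell0 {R}.

(* Main.v *)
(* Let [mu], [nu] be doubling with [nu E > 0], and let [B_i] have centre [x_i] and
   diameter [t_i]. Uniform perfectness gives [mu B(x,s) <= C s^a] on bounded
   regions (likewise for [nu]), and doubling gives [mu B(x,s) >= c_x s^n] with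
   [n] independent of [x]. Choose [e] with [e (n+1) <= a/2]. By Borel-Cantelli,
   [nu]-almost every point is at distance more than [2 t_i^e] from [x_i] for all
   large [i]; let [y] be such a point of [E]. For small [s] every [B_i] meeting
   [B(y,s)] has [t_i^e <= s], so these balls cover at most
   [C s^(n+1) \sum_i t_i^(a/2)] of the [mu]-mass of [B(y,s)], which is less than
   [c_y s^n]. Hence [mu E > 0]. *)

Require Import Defs.
From mathcomp Require Import all_boot all_order all_algebra.
From mathcomp Require Import all_classical all_reals all_analysis.
From mathcomp Require Import ring lra.

Import Order.TTheory GRing.Theory Num.Theory.
Import numFieldNormedType.Exports.

Local Open Scope classical_set_scope.
Local Open Scope ring_scope.

(** * Powers of two and closed balls *)

Lemma exists_exp2_ge (R : archiRealFieldType) (x : R) :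
  exists n : nat, x <= 2 ^+ n.
Proof.
exists (Num.bound `|x|); apply: (le_trans (ler_norm x)).
apply: (le_trans (ltW (archi_boundP (normr_ge0 x)))).
by rewrite -natrX ler_nat ltnW// ltn_expl.
Qed.

Lemma cballS (R : realType) (X : metricType R) (x y : X) (r s : R) :
  mdist y x + r <= s -> cball x r `<=` cball y s.
Proof.
move=> rs z /= xz; apply: le_trans rs.
by rewrite (le_trans (metric_triangle y x z))// lerD2l.
Qed.

Lemma cballSr (R : realType) (X : metricType R) (x : X) (r s : R) :
  r <= s -> cball x r `<=` cball x s.
Proof. by move=> rs; apply: cballS; rewrite mdistxx add0r. Qed.

Lemma open_cballC (R : realType) (X : metricType R) (x : X) (r : R) :
  open (~` cball x r).
Proof.
rewrite openE => y /= /negP; rewrite -ltNge => ry.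
apply/nbhs_ballP; exists (mdist x y - r) => /=; first by rewrite subr_gt0.
move=> z; rewrite ballEmdist /= => yz; apply/negP; rewrite -ltNge.
have := metric_triangle x z y; rewrite (metric_sym z y); lra.
Qed.

Lemma borel_cball (R : realType) (X : metricType R) (x : X) (r : R) :
  borel_set (cball x r).
Proof.
rewrite -(setCK (cball x r)) -setTD.
by apply: sigma_algebraCD; apply: sub_gen_smallest; exact: open_cballC.
Qed.

(** * Doubling measures of balls as positive reals *)

(** Finiteness follows from [C * mu < +oo] with [C >= 1], positivity from the doubling clause at
    radius [r / 2]. *)
Lemma doubling_fine (R : realType) (X : metricType R)
    (mu : {outer_measure set X -> \bar R}) : doubling_measures X mu ->
  exists2 C : R, 1 <= C & forall (x : X) (r : R), 0 < r ->
    [/\ mu (cball x r) = (fine (mu (cball x r)))%:E,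
        0 < fine (mu (cball x r)) &
        fine (mu (cball x (2 * r))) <= C * fine (mu (cball x r))].
Proof.
move=> [_ [C C1 dmu]]; exists C => //.
have fin (x : X) (r : R) : 0 < r -> mu (cball x r) \is a fin_num.
  move=> r0; have [_ _] := dmu x r r0; apply: contraTT.
  rewrite fin_numE negb_and !negbK => /orP[/eqP mu_oo|/eqP ->].
    by have := outer_measure_ge0 mu (cball x r); rewrite mu_oo.
  by rewrite gt0_muley ?ltxx// lte_fin (lt_le_trans _ C1).
move=> x r r0; split; first by rewrite fineK// fin.
  have r20 : 0 < r / 2 by lra.
  have [+ _ _] := dmu x (r / 2) r20; rewrite (_ : 2 * (r / 2) = r); last lra.
  by move=> mu0; rewrite fine_gt0// mu0 -ge0_fin_numE ?fin// outer_measure_ge0.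
have [_ + _] := dmu x r r0.
rewrite -(fineK (fin x r r0)) -(fineK (fin x (2 * r) _)); last lra.
by rewrite lee_fin.
Qed.

Lemma doubling_fine_le (R : realType) (X : metricType R)
    (mu : {outer_measure set X -> \bar R}) (x y : X) (r s : R) :
  doubling_measures X mu -> 0 < r -> 0 < s -> cball x r `<=` cball y s ->
  fine (mu (cball x r)) <= fine (mu (cball y s)).
Proof.
move=> /doubling_fine[C C1 dmu] r0 s0 xy; rewrite -lee_fin.
have [<- _ _] := dmu x r r0; have [<- _ _] := dmu y s s0.
exact: le_outer_measure.
Qed.

Lemma doubling_fine_iter (R : realType) (X : metricType R)
    (mu : {outer_measure set X -> \bar R}) : doubling_measures X mu ->
  exists2 C : R, 1 <= C & forall (x : X) (k : nat) (r : R), 0 < r ->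
    fine (mu (cball x (2 ^+ k * r))) <= C ^+ k * fine (mu (cball x r)).
Proof.
move=> /doubling_fine[C C1 dmu]; exists C => // x; elim=> [|k IH] r r0.
  by rewrite !expr0 !mul1r.
have [|_ _] := dmu x (2 ^+ k * r); first by rewrite mulr_gt0// exprn_gt0.
rewrite mulrA -exprS => /le_trans; apply.
by rewrite exprS -mulrA ler_wpM2l ?IH// (le_trans _ C1).
Qed.

(** The gap between the centres makes the two balls disjoint, and closed balls, being Borel, are
    Carathéodory measurable. *)
Lemma doubling_fine_disjoint (R : realType) (X : metricType R)
    (mu : {outer_measure set X -> \bar R}) (x y z : X) (r s t : R) :
  doubling_measures X mu -> 0 < r -> 0 < s -> 0 < t ->
  cball x r `<=` cball z t -> cball y s `<=` cball z t ->
  r + s < mdist x y ->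
  fine (mu (cball x r)) + fine (mu (cball y s)) <= fine (mu (cball z t)).
Proof.
move=> hmu r0 s0 t0 xz yz rs; have [[mcara _] _] := hmu.
have [C C1 dmu] := doubling_fine _ _ _ hmu; rewrite -lee_fin EFinD.
have [<- _ _] := dmu x r r0; have [<- _ _] := dmu y s s0.
have [<- _ _] := dmu z t t0.
rewrite (mcara _ (borel_cball _ _ x r) (cball z t)) setIidr//.
apply: leeD2l; apply: le_outer_measure => w yw; split; first exact: yz.
move=> xw; move: yw xw; rewrite /cball /= => yw xw.
have := metric_triangle x w y; rewrite (metric_sym w y); lra.
Qed.

(** * Power bounds for the measure of small balls *)

(** Halving the radius costs a factor at most [C <= 2 ^+ n]. Only [c] depends on [x]: the exponent
    must be known before the point is chosen. *)
Lemma doubling_lower_growth (R : realType) (X : metricType R)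
    (mu : {outer_measure set X -> \bar R}) : doubling_measures X mu ->
  exists n : nat, forall x : X, exists2 c : R, 0 < c &
    forall s, 0 < s <= 1 -> c * s ^+ n <= fine (mu (cball x s)).
Proof.
move=> hmu; have [C C1 dmu] := doubling_fine _ _ _ hmu.
have C0 : 0 < C by apply: lt_le_trans C1.
have [n Cn] := exists_exp2_ge _ C.
exists n => x; have [_ m1 _] := dmu x 1 ltr01.
exists (fine (mu (cball x 1)) / C); first by rewrite divr_gt0.
(* Induction on a number [k] of doublings that bring [s] up to scale 1. *)
have H k : forall s, 0 < s <= 1 -> 1 <= 2 ^+ k * s ->
  fine (mu (cball x 1)) / C * s ^+ n <= fine (mu (cball x s)).
  elim: k => [|k IH] s /andP[s0 s1] ks.
    have -> : s = 1 by apply/le_anti; rewrite s1; move: ks; rewrite expr0 mul1r.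
    by rewrite expr1n mulr1 ler_pdivrMr// ler_peMr// ltW.
  have [_ _ d] := dmu x s s0.
  have [s2|s2] := leP (2 * s) 1.
    have := IH (2 * s); rewrite s2 mulr_gt0// mulrA -exprSr => /(_ isT ks).
    rewrite exprMn => h; rewrite -(ler_pM2l C0); apply: le_trans d.
    apply: le_trans h.
    have p0 : 0 <= fine (mu (cball x 1)) / C * s ^+ n.
      by rewrite mulr_ge0// ?exprn_ge0 ?ltW// divr_gt0.
    by rewrite [leRHS]mulrCA ler_wpM2r.
  have : fine (mu (cball x 1)) <= fine (mu (cball x (2 * s))).
    by apply: doubling_fine_le => //; [lra|apply: cballSr; exact: ltW].
  move=> /le_trans /(_ d); rewrite mulrC -ler_pdivrMr// => /(le_trans _); apply.
  by rewrite ler_piMr ?exprn_ile1 ?(ltW s0)// divr_ge0 ?ltW.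
move=> s /andP[s0 s1]; have [k sk] := exists_exp2_ge _ s^-1.
by apply: (H k); rewrite ?s0// -ler_pdivrMr// div1r.
Qed.

(** Uniform perfectness gives [y] with [2s < d(x,y) <= 2Ds]. Then [B(y,s)] is disjoint from
    [B(x,s)], lies in [B(x,4Ds)] and, by doubling, carries a fixed fraction of its mass. *)
Lemma uniformly_perfect_decay (R : realType) (X : metricType R)
    (mu : {outer_measure set X -> \bar R}) :
  uniformly_perfect X -> doubling_measures X mu ->
  exists K l r0 : R, [/\ 2 <= K, 0 < l < 1, 0 < r0 &
    forall (x : X) (s : R), 0 < s < r0 ->
      fine (mu (cball x s)) <= l * fine (mu (cball x (K * s)))].
Proof.
move=> [nX [D D1 up]] hmu.
have D0 : 0 < D by apply: lt_le_trans D1.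
have [C C1 dC] := doubling_fine_iter _ _ _ hmu.
have [[x1 [x2 x12]]|X1] := pselect (exists x y : X, 0 < mdist x y); last first.
  (* Here the space is empty, as a singleton is excluded; the constants are arbitrary. *)
  exists 2, (1/2), 1; split=> //; try lra; move=> x; exfalso; apply: nX.
  exists x; apply/seteqP; split=> // y _; apply/esym/eqP/negPn/negP => xy.
  by apply: X1; exists x, y; rewrite mdist_gt0.
(* [8 * D] suffices for [B(x,4Ds)] to lie in [B(y,8Ds)]. The added 1 keeps [(L - 1) / L] positive
   even if [C ^+ k = 1]. *)
have [k kD] := exists_exp2_ge _ (8 * D); pose L := C ^+ k + 1.
have L0 : 1 < L by rewrite ltrDr exprn_gt0// (lt_le_trans _ C1).
exists (4 * D), ((L - 1) / L), (mdist x1 x2 / (4 * D)); split.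
- lra.
- by apply/andP; split; [apply: divr_gt0|rewrite ltr_pdivrMr]; lra.
- by rewrite divr_gt0//; lra.
move=> x s /andP[s0 sr].
(* So [B(x,2Ds)] cannot contain both [x1] and [x2]. *)
have r4 : 4 * (s * D) < mdist x1 x2 by move: sr; rewrite ltr_pdivlMr; lra.
have sD0 : 0 < s * D by rewrite mulr_gt0.
have [] := up x (2 * D * s).
- by rewrite -mulrA (mulrC D); lra.
- apply: contrapT => full.
  have in_ball z : mdist x z <= 2 * D * s.
    by apply: contrapT => xz; apply: full; exists z.
  have := metric_triangle x1 x x2; rewrite (metric_sym x1 x).
  by have := in_ball x1; have := in_ball x2; lra.
rewrite (_ : 2 * D * s / D = 2 * s); last by rewrite mulrAC mulfK ?gt_eqF.
move=> y []; rewrite /cball /= => xy /negP; rewrite -ltNge => yx.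
have sDs : s <= s * D by rewrite ler_peMr// ltW.
have h1 : fine (mu (cball x s)) + fine (mu (cball y s))
    <= fine (mu (cball x (4 * D * s))).
  apply: doubling_fine_disjoint => //; try lra.
  - by apply: cballSr; lra.
  - by apply: cballS; lra.
have h2 : fine (mu (cball x (4 * D * s))) <= C ^+ k * fine (mu (cball y s)).
  apply: le_trans (dC y k s s0).
  have : 8 * D * s <= 2 ^+ k * s by rewrite ler_wpM2r// ltW.
  move=> kDs; apply: doubling_fine_le => //; [lra|lra|].
  by apply: cballS; rewrite metric_sym; lra.
rewrite mulrAC ler_pdivlMr; last lra.
have [C2 _ dmu] := doubling_fine _ _ _ hmu; have [_ my _] := dmu y s s0.
have := ler_wpM2l (exprn_ge0 k (le_trans ler01 C1)) h1; rewrite /L; lra.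
Qed.

(* With [l = K^-a], the decay [mu B(x,s) <= l mu B(x,Ks)] propagates the bound
   [C s^a] from the scale [Ks] down to [s]. *)
Lemma doubling_upper_growth (R : realType) (X : metricType R)
    (mu : {outer_measure set X -> \bar R}) (x0 : X) (r : R) :
  uniformly_perfect X -> doubling_measures X mu -> 0 < r ->
  exists a C : R, [/\ 0 < a, 0 < C &
    forall x s, mdist x0 x <= r -> 0 < s <= r ->
      fine (mu (cball x s)) <= C * s `^ a].
Proof.
move=> hX hmu r_gt0.
have [K [l [r0 [K2 /andP[l0 l1] r00 decay]]]] :=
  uniformly_perfect_decay _ _ _ hX hmu.
have K0 : 0 < K by lra.
have K1 : 1 < K by lra.
have [C C1 dmu] := doubling_fine _ _ _ hmu.
pose M := fine (mu (cball x0 (2 * r))).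
have M0 : 0 < M by have [|//] := dmu x0 (2 * r); lra.
pose a := - ln l / ln K.
have a0 : 0 < a by rewrite divr_gt0 ?ln_gt0// oppr_gt0 ln_lt0// l0.
have Ka : l * K `^ a = 1.
  rewrite /powR gt_eqF// /a mulfVK ?gt_eqF ?ln_gt0// expRN lnK ?posrE//.
  by rewrite mulfV// gt_eqF.
(* Below [r1] the decay applies and [K * s] stays within [r]; from [r1] on, the crude bound [M]
   suffices. *)
pose r1 := Num.min (r0 / K) (r / K).
have r1_gt0 : 0 < r1 by rewrite lt_min !divr_gt0.
exists a, (M / r1 `^ a); split=> //; first by rewrite divr_gt0// powR_gt0.
move=> x + x0x.
have H k : forall s, 0 < s <= r -> r1 <= K ^+ k * s ->
    fine (mu (cball x s)) <= M / r1 `^ a * s `^ a.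
  have large s : 0 < s <= r -> r1 <= s ->
      fine (mu (cball x s)) <= M / r1 `^ a * s `^ a.
    move=> /andP[s0 sr] rs; apply: (@le_trans _ _ M).
      by apply: doubling_fine_le => //; [lra|apply: cballS; lra].
    rewrite -mulrA ler_peMr ?(ltW M0)// mulrC ler_pdivlMr ?powR_gt0// mul1r.
    by apply: ge0_ler_powR; rewrite ?nnegrE// ltW.
  elim: k => [|k IH] s sr ks; first by apply: large; rewrite // -(mul1r s).
  have [|sr1] := leP r1 s; first exact: large.
  have /andP[s0 _] := sr.
  move: sr1; rewrite lt_min !ltr_pdivlMr// => /andP[sr0 sr1].
  have sK : s < s * K by rewrite ltr_pMr.
  have := decay x s; rewrite s0 => /(_ (lt_trans sK sr0)) /le_trans; apply.
  have Ks : 0 < K * s <= r by rewrite mulr_gt0//= mulrC ltW.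
  have := IH (K * s) Ks; rewrite mulrA -exprSr => /(_ ks) h.
  apply: (le_trans (ler_wpM2l (ltW l0) h)).
  by rewrite powRM ?(ltW s0) ?(ltW K0)// mulrCA (mulrA l) Ka mul1r.
move=> s /[dup] sr /andP[s0 _]; have [k sk] := exists_exp2_ge _ (r1 / s).
apply: (H k) => //; rewrite -ler_pdivrMr//; apply: (le_trans sk).
by rewrite lerXn2r// nnegrE ltW.
Qed.

(** * Borel-Cantelli and the exceptional null set *)

(** The limsup set lies in every tail union, whose measure is at most a tail of the convergent
    series. *)
Lemma outer_borel_cantelli (R : realType) (T : Type)
    (mu : {outer_measure set T -> \bar R}) (A : nat -> set T) :
  (\sum_(0 <= i <oo) mu (A i) < +oo)%E -> mu (lim_sup_set A) = 0%E.
Proof.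
move=> sA; apply/le_anti/andP; split; last exact: outer_measure_ge0.
have tail := nneseries_tail_cvg sA (fun i _ => outer_measure_ge0 mu (A i)).
rewrite -(cvg_lim _ tail)//; apply: lime_ge; first by apply/cvg_ex; exists 0%E.
apply: nearW => N; apply: le_trans (outer_measure_sigma_subadditive_tail mu N A).
apply: le_outer_measure => x /(_ N I)[i /= Ni Aix]; exists i => //=.
by apply/negP; rewrite -leqNgt.
Qed.

(** The upper bound makes the measures [O(t_i^(e b))], summable however small [e b] is because [t]
    is in [ell0]. Distant centres are discarded since that bound is uniform only on bounded
    regions. *)
Lemma doubling_null_limsup (R : realType) (X : metricType R)
    (nu : {outer_measure set X -> \bar R}) (x0 : X) (r e : R)
    (x : nat -> X) (t : nat -> R) :
  uniformly_perfect X -> doubling_measures X nu -> 2 <= r -> 0 < e ->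
  ell0 t ->
  nu (lim_sup_set (fun i => if mdist x0 (x i) <= r
                            then cball (x i) (2 * t i `^ e) else set0)) = 0%E.
Proof.
move=> hX hnu r2 e0 ht; have r0 : 0 < r by lra.
have [b [C [b0 C0 up]]] := doubling_upper_growth _ _ _ x0 r hX hnu r0.
have [C1 _ dnu] := doubling_fine _ _ _ hnu.
have eb0 : 0 < e * b by rewrite mulr_gt0.
have [t01 sumt] := ht _ eb0.
apply: outer_borel_cantelli.
apply: (@le_lt_trans _ _ (\sum_(0 <= i <oo)
    (C * 2 `^ b)%:E * (t i `^ (e * b))%:E)%E); last first.
  rewrite nneseriesZl; last by move=> i _; rewrite lee_fin powR_ge0.
  rewrite lte_mul_pinfty ?lee_fin ?mulr_ge0 ?powR_ge0// ltW//.
apply: lee_nneseries => [i _ _|i _]; first exact: outer_measure_ge0.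
have /andP[ti0 ti1] := t01 i; case: ifPn => [x0x|_]; last first.
  by rewrite outer_measure0 -EFinM lee_fin !mulr_ge0 ?powR_ge0// ltW.
have te0 : 0 < 2 * t i `^ e by rewrite mulr_gt0// powR_gt0.
have te2 : 2 * t i `^ e <= r.
  apply: le_trans r2; rewrite ler_piMr// -(powRr0 (t i)).
  by apply: ger_powR; rewrite ?ti0 ltW.
have [-> _ _] := dnu (x i) _ te0.
rewrite -EFinM lee_fin powRrM -mulrA -powRM ?powR_ge0//.
by apply: up; rewrite // te0.
Qed.

(** * Positive measure near a good point *)

(** Were the complement null, summing over the balls that meet [B(y,s)] would give
    [c s^n <= C S s^(n+1)], which fails for small [s]. *)
Lemma doubling_pos_outside (R : realType) (X : metricType R)
    (mu : {outer_measure set X -> \bar R}) (a C e : R) (n : nat)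
    (x : nat -> X) (rho t : nat -> R) (y : X) (N : nat) (c : R) :
  doubling_measures X mu -> 0 < a -> 0 < C -> 0 < c ->
  0 < e <= 1 -> e * n.+1%:R <= a / 2 -> ell0 t ->
  (forall i, cball (x i) (rho i) `<=` cball (x i) (t i)) ->
  (forall i, mdist y (x i) <= 2 ->
    (mu (cball (x i) (t i)) <= (C * t i `^ a)%:E)%E) ->
  (forall s, 0 < s <= 1 -> c * s ^+ n <= fine (mu (cball y s))) ->
  (forall i, ~ cball (x i) (rho i) y) ->
  (forall i, (N <= i)%N -> mdist y (x i) <= 2 -> 2 * t i `^ e < mdist y (x i)) ->
  (0 < mu (~` \bigcup_i cball (x i) (rho i)))%E.
Proof.
move=> hmu a0 C0 c0 /andP[e0 e1] ea ht rt up low yB far.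
have [C1 _ dmu] := doubling_fine _ _ _ hmu.
have a20 : 0 < a / 2 by lra.
have [t01 sumt] := ht _ a20.
have sum_ge0 : (0 <= \sum_(0 <= i <oo) (t i `^ (a / 2))%:E)%E.
  by apply: nneseries_ge0 => i _ _; rewrite lee_fin powR_ge0.
pose S := fine (\sum_(0 <= i <oo) (t i `^ (a / 2))%:E)%E.
have SE : (\sum_(0 <= i <oo) (t i `^ (a / 2))%:E)%E = S%:E.
  by rewrite fineK// ge0_fin_numE.
have S0 : 0 <= S by rewrite fine_ge0.
(* The first [N] balls are closed and miss [y], so one radius avoids them all. *)
have [d d0 hd] : exists2 d : R, 0 < d &
    forall i, (i < N)%N -> cball y d `&` cball (x i) (rho i) = set0.
  elim: (N) => [|m [d d0 hd]]; first by exists 1.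
  have xm : rho m < mdist (x m) y.
    by rewrite ltNge; apply/negP; exact: yB.
  exists (Num.min d ((mdist (x m) y - rho m) / 2)).
    by rewrite lt_min d0; lra.
  move=> i; rewrite ltnS leq_eqVlt => /orP[/eqP ->|im].
    rewrite -subset0 => z []; rewrite /cball /= le_min => /andP[_ yz] xz.
    have := metric_triangle (x m) z y; rewrite (metric_sym z y); lra.
  rewrite -subset0 -(hd i im) => z [yz xz]; split=> //.
  by apply: cballSr yz; rewrite ge_min lexx.
(* The last bound forces [C * S * s < c]; the added 1 covers [C * S = 0]. *)
pose s := Num.min 1 (Num.min d (c / (2 * (C * S + 1)))).
have CS0 : 0 <= C * S by rewrite mulr_ge0// ltW.
have s0 : 0 < s by rewrite !lt_min ltr01 d0 divr_gt0//; lra.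
have s1 : s <= 1 by rewrite ge_min lexx.
have sd : s <= d by rewrite /s !ge_min lexx orbT.
have sc : s <= c / (2 * (C * S + 1)) by rewrite /s !ge_min lexx !orbT.
have small i : (mu (cball y s `&` cball (x i) (rho i)) <=
    (C * s ^+ n.+1)%:E * (t i `^ (a / 2))%:E)%E.
  have rhs0 : (0 <= (C * s ^+ n.+1)%:E * (t i `^ (a / 2))%:E)%E.
    rewrite -EFinM lee_fin !mulr_ge0 ?powR_ge0 ?exprn_ge0//; exact: ltW.
  have [->|/set0P[z [yz xz]]] :=
      eqVneq (cball y s `&` cball (x i) (rho i)) set0.
    by rewrite outer_measure0.
  have iN : (N <= i)%N.
    rewrite leqNgt; apply/negP => iN; have := hd i iN; rewrite -subset0.
    by apply; split; [exact: cballSr yz|exact: xz].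
  have /andP[ti0 ti1] := t01 i.
  have tte : t i <= t i `^ e by apply: ger1_powR; rewrite // ti0 ltW.
  have yxi : mdist y (x i) <= s + t i.
    apply: (le_trans (metric_triangle y z (x i))); apply: lerD => //.
    by rewrite metric_sym; exact: rt xz.
  have y2 : mdist y (x i) <= 2 by lra.
  (* A ball meeting [B(y,s)] is tiny: [t^e <= s], so its [t^(a/2)] beats [s^n]. *)
  have tes : t i `^ e <= s by have := far i iN y2; lra.
  apply: (@le_trans _ _ (C * t i `^ a)%:E).
    apply: le_trans (up i y2); apply: le_outer_measure => w [_ xw].
    exact: rt xw.
  rewrite -EFinM lee_fin -mulrA ler_wpM2l//; first exact: ltW.
  (* One factor [t^(a/2)] is kept for summation; the other is at most [t^(e(n+1)) <= s^(n+1)]. *)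
  rewrite {1}(splitr a) powRD; last by rewrite gt_eqF ?implybT//; lra.
  rewrite ler_wpM2r ?powR_ge0//.
  apply: (@le_trans _ _ (t i `^ (e * n.+1%:R))).
    by apply: ger_powR; rewrite // ti0 ltW.
  by rewrite powRrM powR_mulrn ?powR_ge0// lerXn2r// nnegrE ?powR_ge0// ltW.
rewrite lt_neqAle outer_measure_ge0 andbT; apply/eqP => /esym muE.
have : (mu (cball y s) <= (C * s ^+ n.+1)%:E * S%:E)%E.
  apply: (le_trans (le_outer_measureIC mu (\bigcup_i cball (x i) (rho i)) _)).
  rewrite [X in (_ + X)%E](_ : _ = 0%E) ?adde0; last first.
    apply/le_anti; rewrite outer_measure_ge0 andbT -muE.
    by apply: le_outer_measure; exact: subIsetr.
  apply: (le_trans (outer_measure_bigcup_lim mu _ _)).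
  rewrite -SE -nneseriesZl; last by move=> i _; rewrite lee_fin powR_ge0.
  by apply: lee_nneseries => // i _ _; exact: outer_measure_ge0.
have [-> _ _] := dmu y s s0; rewrite -EFinM lee_fin.
have := low s; rewrite s0 => /(_ s1) /le_trans h /h.
rewrite (_ : C * s ^+ n.+1 * S = C * S * s * s ^+ n);
  last by rewrite exprS; ring.
rewrite ler_pM2r ?exprn_gt0//.
by move: sc; rewrite ler_pdivlMr; nra.
Qed.

(** * Diameters and bounded pieces *)

Lemma diam_cball_fin (R : realType) (X : metricType R) (x : X) (r : R) :
  0 <= r -> diam (cball x r) \is a fin_num.
Proof.
move=> r0; have xx : cball x r x by rewrite /cball /= mdistxx.
have d0 : (0 <= diam (cball x r))%E.
  by apply: ereal_sup_ubound; exists (x, x) => //=; rewrite mdistxx.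
rewrite ge0_fin_numE//; apply: (@le_lt_trans _ _ (r + r)%:E); last exact: ltry.
apply: ge_ereal_sup => _ [[y z] [/= xy xz] <-]; rewrite lee_fin.
apply: (le_trans (metric_triangle y x z)); rewrite (metric_sym y x).
exact: lerD.
Qed.

(** Replaces the radius, which may far exceed the diameter, by the quantity that is summable. *)
Lemma cball_sub_diam (R : realType) (X : metricType R) (x : X) (r : R) :
  0 <= r -> cball x r `<=` cball x (fine (diam (cball x r))).
Proof.
move=> r0 y xy; rewrite /cball /= -lee_fin fineK ?diam_cball_fin//.
apply: ereal_sup_ubound; exists (x, y) => //=; split => //.
by rewrite /cball /= mdistxx.
Qed.

Lemma outer_measure_neq0_cball (R : realType) (X : metricType R)
    (nu : {outer_measure set X -> \bar R}) (x0 : X) (A : set X) :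
  nu A != 0%E -> exists2 r : R, 0 < r & nu (A `&` cball x0 r) != 0%E.
Proof.
move=> /eqP nuA; apply: contrapT => nor; apply: nuA.
apply/le_anti; rewrite outer_measure_ge0 andbT.
apply: (@le_trans _ _ (nu (A `&` \bigcup_k cball x0 k.+1%:R))).
  apply: le_outer_measure => y Ay; split=> //.
  have := archi_boundP (mdist_ge0 x0 y); set k := Num.bound _ => k1.
  by exists k => //; rewrite /cball /= (le_trans (ltW k1))// ler_nat.
apply: (le_trans (outer_measure_bigcup_lim nu _ _)).
rewrite eseries0// => k _ _; apply/eqP/negPn/negP => nuk; apply: nor.
by exists k.+1%:R.
Qed.

(** * Transfer of null sets between doubling measures *)

Lemma doubling_null_transfer (R : realType) (X : metricType R)
    (mu nu : {outer_measure set X -> \bar R})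
    (x : nat -> X) (rho t : nat -> R) :
  uniformly_perfect X -> doubling_measures X mu -> doubling_measures X nu ->
  ell0 t -> (forall i, cball (x i) (rho i) `<=` cball (x i) (t i)) ->
  mu (~` \bigcup_i cball (x i) (rho i)) = 0%E ->
  nu (~` \bigcup_i cball (x i) (rho i)) = 0%E.
Proof.
move=> hX hmu hnu ht rt; set E := ~` _ => muE.
apply/eqP/negPn/negP => nuE.
have [x0 _] : E !=set0.
  by apply/set0P/eqP => E0; rewrite E0 outer_measure0 eqxx in nuE.
have [r0 r0_gt0 nuEr] := outer_measure_neq0_cball _ _ nu x0 _ nuE.
(* The margin 2 keeps every centre within 2 of a point of [B(x0,r0)] inside [B(x0,r)]. *)
pose r := r0 + 2; have r_gt0 : 0 < r by rewrite /r; lra.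
have [C1 _ dmu] := doubling_fine _ _ _ hmu.
have [a [C [a0 C0 up]]] := doubling_upper_growth _ _ _ x0 r hX hmu r_gt0.
have [n low] := doubling_lower_growth _ _ _ hmu.
(* The cap 1 ensures [t <= t^e] for [t < 1]. *)
pose e := Num.min 1 (a / 2 / n.+1%:R).
have e0 : 0 < e by rewrite lt_min ltr01 !divr_gt0.
have e1 : 0 < e <= 1 by rewrite e0 ge_min lexx.
have ea : e * n.+1%:R <= a / 2.
  by rewrite -ler_pdivlMr// ge_min lexx orbT.
have nuL : nu (lim_sup_set (fun i => if mdist x0 (x i) <= r
    then cball (x i) (2 * t i `^ e) else set0)) = 0%E.
  by apply: doubling_null_limsup => //; rewrite /r; lra.
have [y [[Ey x0y] yL]] : (E `&` cball x0 r0) `\` lim_sup_set (fun i =>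
    if mdist x0 (x i) <= r then cball (x i) (2 * t i `^ e) else set0) !=set0.
  apply/set0P; apply: contra nuEr => /eqP; rewrite setD_eq0 => sub.
  apply/eqP/le_anti; rewrite outer_measure_ge0 andbT -nuL.
  exact: le_outer_measure.
have xi_near i : mdist y (x i) <= 2 -> mdist x0 (x i) <= r.
  move=> yxi; apply: (le_trans (metric_triangle x0 y (x i))).
  by rewrite /r lerD.
have [N yN] : exists N, forall i, (N <= i)%N -> mdist y (x i) <= 2 ->
    2 * t i `^ e < mdist y (x i).
  apply: contrapT => noN; apply: yL => N _; apply: contrapT => yN.
  apply: noN; exists N => i Ni yxi; rewrite ltNge; apply/negP => yi.
  apply: yN; exists i => //; rewrite (xi_near i yxi).
  by rewrite /cball /= metric_sym.
have [c c0 lowy] := low y.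
suff : (0 < mu E)%E by rewrite muE ltxx.
apply: (@doubling_pos_outside _ _ mu a C e n x rho t y N c) => //.
- move=> i yxi; have [/(_ i)/andP[ti0 ti1] _] := ht 1 ltr01.
  have [-> _ _] := dmu (x i) (t i) ti0; rewrite lee_fin.
  by apply: up; [exact: xi_near|rewrite ti0 /r; lra].
- by move=> i yi; apply: Ey; exists i.
Qed.

(* [fine] loses nothing: a closed ball of radius [r] has diameter at most
   [2 * r]. *)
Theorem theorem1p1 (R : realType) (X : metricType R)
    (hX : uniformly_perfect X)
    (B : nat -> set X)
    (hB : forall i, exists (x : X) (r : R), 0 < r /\ B i = cball x r)
    (hdiam : ell0 (fun i => fine (diam (B i)))) :
  let E := [set: X] `\` \bigcup_i B i in
  fat E \/ thin E.
Proof.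
move=> E.
have ball_data i : exists z : X * R, 0 < z.2 /\ B i = cball z.1 z.2.
  by have [x [r xr]] := hB i; exists (x, r).
have [xr xrP] := choice ball_data.
have EE : E = ~` \bigcup_i cball (xr i).1 (xr i).2.
  rewrite /E setTD; congr (~` _); apply: eq_bigcupr => i _.
  by have [_ ->] := xrP i.
have sub i : cball (xr i).1 (xr i).2 `<=` cball (xr i).1 (fine (diam (B i))).
  by have [r0 ->] := xrP i; apply: cball_sub_diam; exact: ltW.
(* One doubling measure vanishing on [E] forces all to vanish; if there is none, [E] is fat,
   including when no doubling measure exists. *)
have [[mu hmu muE]|fatE] :=
  pselect (exists2 mu, doubling_measures X mu & mu E = 0%E).
  right => nu hnu; move: muE; rewrite EE.
  exact: (doubling_null_transfer _ _ mu nu _ _ _ hX hmu hnu hdiam sub).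
left => mu hmu; rewrite lt_neqAle outer_measure_ge0 andbT.
by apply/eqP => /esym muE; apply: fatE; exists mu.
Qed.
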